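(* Let $\Gamma=(V,E)$ be a reduced graph. Then $\mathrm{Aut}^{\pi}(\Gamma)\le\mathrm{Aut}(\Gamma^2)$.
   Context: Graphs are finite, simple, loopless; $N(v)$ is the neighbourhood of $v$; reduced means $N(v)=N(w)\Rightarrow v=w$. $\mathrm{Aut}^{\pi}(\Gamma)$ is the group of bijections $\pi$ of $V$ such that for every $v$ there exists $w$ with $\pi(N(v))=N(w)$. $\Gamma^2$ has vertex set $V$, with $v_1$ adjacent to $v_2$ if and only if there exists $u\in V$ with $(v_1,u),(u,v_2)\in E$; $\mathrm{Aut}(\Gamma^2)$ is the group of permutations of $V$ preserving this adjacency relation. *)

(* Defs.v *)
From mathcomp Require Import all_boot all_fingroup.

Set Implicit Arguments.
Unset Strict Implicit.
Unset Printing Implicit Defensive.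

Import GroupScope.

Record sgraph (V : finType) := SGraph {
  adj :> rel V;
  adj_sym : symmetric adj;
  adj_irr : irreflexive adj }.

Section GraphAut.

Variable V : finType.
Implicit Types G : sgraph V.

Definition nbhd G (v : V) : {set V} := [set u | adj G v u].

Definition reduced G : Prop := forall v w : V, nbhd G v = nbhd G w -> v = w.

Definition Aut_pi G : {set {perm V}} :=
  [set p : {perm V} | [forall v, exists w, p @: nbhd G v == nbhd G w]].

(* v1 = v2 is not excluded, so this relation holds at (v, v) whenever v has a
   neighbour; it is therefore a plain relation and not an sgraph. *)
Definition square_adj G : rel V :=
  [rel v1 v2 | [exists u, adj G v1 u && adj G u v2]].

Definition Aut_rel (r : rel V) : {set {perm V}} :=
  [set p : {perm V} | [forall x, forall y, r (p x) (p y) == r x y]].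

Fact Aut_pi_group_set G : group_set (Aut_pi G).
Proof.
apply/group_setP; split=> [|p q].
  rewrite inE; apply/forallP=> v; apply/existsP; exists v; apply/eqP.
  by rewrite (eq_imset _ (@perm1 V)) imset_id.
rewrite !inE => /forallP Hp /forallP Hq; apply/forallP=> v.
have /existsP[w /eqP Ew] := Hp v; have /existsP[z /eqP Ez] := Hq w.
apply/existsP; exists z; apply/eqP.
by rewrite -Ez -Ew -imset_comp; apply: eq_imset => x; rewrite permM.
Qed.

Canonical Aut_pi_group G := Group (Aut_pi_group_set G).

Fact Aut_rel_group_set (r : rel V) : group_set (Aut_rel r).
Proof.
apply/group_setP; split=> [|p q].
  by rewrite inE; apply/forallP=> x; apply/forallP=> y; rewrite !perm1.
rewrite !inE => /'forall_'forall_eqP Hp /'forall_'forall_eqP Hq.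
by apply/'forall_'forall_eqP=> x y; rewrite !permM Hq Hp.
Qed.

Canonical Aut_rel_group (r : rel V) := Group (Aut_rel_group_set r).

End GraphAut.

(* Main.v *)
(** Two vertices are adjacent in the square of [G] exactly when some
    neighbourhood contains both, and an element of [Aut_pi G] sends
    neighbourhoods to neighbourhoods, so it preserves this relation. Since
    [Aut_pi G] is a group, the inverse permutation preserves it too. *)
Require Import Defs.
From mathcomp Require Import all_boot all_fingroup.

Set Implicit Arguments.
Unset Strict Implicit.
Unset Printing Implicit Defensive.

Import GroupScope.

(** By symmetry of [adj], the middle vertex of a walk of length two has both ends in its
    neighbourhood. Phrased this way, the relation involves only neighbourhoods, which is what
    [Aut_pi G] controls. *)
Lemma square_adjP (V : finType) (G : sgraph V) (x y : V) :
  reflect (exists u, x \in nbhd G u /\ y \in nbhd G u) (square_adj G x y).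
Proof.
apply: (iffP existsP) => [[u /andP[xu uy]]|[u []]].
  by exists u; rewrite !inE (adj_sym G u x).
by rewrite !inE => ux uy; exists u; rewrite (adj_sym G x u) ux.
Qed.

Lemma Aut_pi_square_adj (V : finType) (G : sgraph V) (p : {perm V}) (x y : V) :
  p \in Aut_pi G -> square_adj G x y -> square_adj G (p x) (p y).
Proof.
rewrite inE => /forallP Hp /square_adjP[u [ux uy]].
(* The new middle vertex [w] need not be [p u]. *)
have /existsP[w /eqP pNu] := Hp u.
by apply/square_adjP; exists w; rewrite -pNu !imset_f.
Qed.

Theorem theorem3p2 (V : finType) (G : sgraph V) (redG : reduced G) :
  Aut_pi_group G \subset Aut_rel_group (square_adj G).
Proof.
apply/subsetP => p pG; rewrite inE; apply/'forall_'forall_eqP => x y.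
apply/idP/idP; last exact: Aut_pi_square_adj.
(* Reflection of adjacency is preservation by [p^-1], taken at [p x] and [p y]. *)
by move/(Aut_pi_square_adj (groupVr pG)); rewrite !permK.
Qed.
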